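(* Let $t,m\in\mathbb{N}$ and let $[m]=P_1\,\dot\cup\,\cdots\,\dot\cup\,P_t$ be a partition of $[m]$ into subsets $P_1,\ldots,P_t$. Let $\mathcal{P}\subseteq[m]$, let $U=\{\sum_{i\in\mathcal{P}}a_i\boldsymbol{e}_i : a_i\in\mathbb{R}\}\subseteq\mathbb{R}^m$, and let $\varphi:U\to\mathbb{R}$ be convex and positively homogeneous. Suppose that $f:U\to\mathbb{R}$ is one of the following functions: (i) a concave and positively homogeneous function; (ii) for given real numbers $\alpha_{ij}$ ($i\in[t]$, $j\in[|P_i|]$), $f(\boldsymbol{a})=\sum_{i=1}^{t}\sum_{j=1}^{|P_i|}\alpha_{ij}\,\boldsymbol{a}^{i}_{\downarrow j}$, where $\boldsymbol{a}^{i}=\boldsymbol{a}_{|P_i}$. Then the following statements are equivalent: (1) For every $\boldsymbol{a}\in U$, $\varphi(\boldsymbol{a})\le f(\boldsymbol{a})$. (2) For every $\boldsymbol{a}\in U_{\{0,\pm1\}}$, $\varphi(\boldsymbol{a})\le f(\boldsymbol{a})$.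
   Context: $[m]=\{1,\ldots,m\}$; a partition consists of pairwise disjoint nonempty subsets. $\boldsymbol{e}_i$ is the $i$-th standard basis vector of $\mathbb{R}^m$. For $\boldsymbol{x}\in\mathbb{R}^m$ and $P\subseteq[m]$, $\boldsymbol{x}_{|P}$ is the restriction of $\boldsymbol{x}$ to the coordinates indexed by $P$. For a vector $\boldsymbol{x}$ with $p$ coordinates, $\boldsymbol{x}_{\downarrow1}\ge\cdots\ge\boldsymbol{x}_{\downarrow p}$ denotes its coordinates arranged in decreasing order. A function $g$ is positively homogeneous if $g(\alpha\boldsymbol{v})=\alpha g(\boldsymbol{v})$ for all real $\alpha>0$ and all $\boldsymbol{v}$ in its domain. $U_{\{0,\pm1\}}=\{(a_1,\ldots,a_m)\in U: a_i\in\{-1,0,1\}\text{ for all } i\in[m]\}$. *)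

(* Defs.v *)
From mathcomp Require Import all_boot all_order all_algebra.
From mathcomp Require Import all_classical all_reals all_analysis.

Set Implicit Arguments.
Unset Strict Implicit.
Unset Printing Implicit Defensive.

Import Order.TTheory GRing.Theory Num.Theory.

Local Open Scope classical_set_scope.
Local Open Scope ring_scope.

(* Functions D -> R on a subset D of a module E are represented by total
   functions E -> R; every hypothesis on them is restricted to D. *)

Definition concave_function (R : realType) (E : lmodType R) (D : set E)
    (f : E -> R) : Prop :=
  @convex_function R E D (fun x => - f x).

Definition pos_homogeneous (R : realType) (E : lmodType R) (D : set E)
    (g : E -> R) : Prop :=
  forall (alpha : R) (v : E), 0 < alpha -> D v -> g (alpha *: v) = alpha * g v.

Definition coord_space (R : realType) (m : nat) (S : {set 'I_m}) :
    set 'rV[R]_m :=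
  [set x | exists a : 'I_m -> R, x = \sum_(i in S) a i *: delta_mx 0 i].

Definition sign_vectors (R : realType) (m : nat) (U : set 'rV[R]_m) :
    set 'rV[R]_m :=
  [set a | U a /\ forall i : 'I_m, a 0 i \in [:: -1; 0; 1]].

Definition restrict_row (R : realType) (m : nat) (x : 'rV[R]_m)
    (P : {set 'I_m}) : 'rV[R]_#|P| :=
  \row_(j < #|P|) x 0 (enum_val j).

(* [decr x j] is the (j+1)-st largest coordinate of x, with multiplicity. *)
Definition decr (R : realType) (p : nat) (x : 'rV[R]_p) (j : 'I_p) : R :=
  (sort >=%R [seq x 0 k | k <- enum 'I_p])`_j.

(* Main.v *)
(* By homogeneity and convexity, phi is subadditive. Soft thresholding at the
   smallest nonzero absolute value c of the coordinates of a writes a as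
   b + c *: sgr a, where b has strictly fewer nonzero coordinates. Both summands
   are obtained from a by coordinatewise nondecreasing maps, which commute with
   sorting, so in case (ii) f is additive on this decomposition; in case (i) f is
   superadditive. Hence phi a <= phi b + c * phi (sgr a) <= f b + c * f (sgr a)
   <= f a by induction on the size of the support. *)
Require Import Defs.
From mathcomp Require Import all_boot all_order all_algebra.
From mathcomp Require Import all_classical all_reals all_analysis.
From mathcomp Require Import lra.

Set Implicit Arguments.
Unset Strict Implicit.
Unset Printing Implicit Defensive.

Import Order.TTheory GRing.Theory Num.Theory.

Local Open Scope classical_set_scope.
Local Open Scope ring_scope.

Lemma coord_spaceP (R : realType) m (S : {set 'I_m}) (x : 'rV[R]_m) :
  coord_space S x <-> forall i, i \notin S -> x 0 i = 0.
Proof.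
split=> [[a ->] i iS|x0].
  rewrite summxE big1// => j jS; rewrite !mxE eqxx/=.
  by case: eqVneq => [ij|_]; [rewrite ij jS in iS|rewrite mulr0].
exists (fun i => x 0 i); rewrite {1}(row_sum_delta x) [LHS](bigID (mem S))/=.
by rewrite [X in _ + X]big1 ?addr0// => i /x0 ->; rewrite scale0r.
Qed.

Lemma coord_space_map (R : realType) m (S : {set 'I_m}) (g : R -> R)
    (x : 'rV[R]_m) :
  g 0 = 0 -> coord_space S x -> coord_space S (map_mx g x).
Proof. by move=> g0 /coord_spaceP xS; apply/coord_spaceP => i /xS; rewrite mxE => ->. Qed.

(** Write [x + y] as the midpoint of [2 *: x] and [2 *: y]; homogeneity then cancels the weights one
    half against the factors 2. *)
Lemma convex_pos_homogeneous_subadd (R : realType) (E : lmodType R) (D : set E)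
    (g : E -> R) :
  (forall c x, 0 < c -> D x -> D (c *: x)) ->
  @convex_function R E D g -> pos_homogeneous D g ->
  forall x y, D x -> D y -> g (x + y) <= g x + g y.
Proof.
move=> DZ gconv ghom x y Dx Dy.
have h01 : 0 <= (2^-1 : R) <= 1 by lra.
pose t : {i01 R} := Itv01 (andP h01).1 (andP h01).2.
have D2 z : D z -> D (2 *: z) by exact: DZ.
have := gconv t (2 *: x) (2 *: y) (mem_set (D2 _ Dx)) (mem_set (D2 _ Dy)).
rewrite convRE !ghom//= /conv/= /unstable.onem !scalerA.
have -> : (1 - 2^-1) = 2^-1 :> R by lra.
by rewrite mulVf ?pnatr_eq0// !scale1r !mulKf ?pnatr_eq0.
Qed.

(** A nondecreasing [g] keeps a decreasingly sorted list sorted, and two sorted lists that are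
    permutations of each other coincide. *)
Lemma decr_map (R : realType) p (g : R -> R) (x : 'rV[R]_p) j :
  {homo g : u v / u <= v} -> decr (map_mx g x) j = g (decr x j).
Proof.
move=> gmono; rewrite /decr.
have -> : [seq map_mx g x 0 k | k <- enum 'I_p] =
          map g [seq x 0 k | k <- enum 'I_p].
  by rewrite -map_comp; apply: eq_map => k /=; rewrite mxE.
have -> s : sort >=%R (map g s) = map g (sort >=%R s).
  apply: (sorted_eq (@ge_trans _ R)).
  - by move=> u v /andP[uv vu]; apply/le_anti/andP.
  - by apply: sort_sorted => u v; exact: le_total.
  - rewrite (homo_sorted (f := g) (e := >=%R))//; first by move=> u v; exact: gmono.
    by apply: sort_sorted => u v; exact: le_total.
  - by rewrite perm_sort; apply: perm_map; rewrite perm_sym perm_sort.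
(* The index [j] is in range, so the default 0 is never read and [g 0] may be arbitrary. *)
by rewrite (nth_map 0)// size_sort size_map size_enum_ord.
Qed.

Lemma restrict_row_map (R : realType) m (g : R -> R) (x : 'rV[R]_m)
    (A : {set 'I_m}) :
  restrict_row (map_mx g x) A = map_mx g (restrict_row x A).
Proof. by apply/rowP => j; rewrite !mxE. Qed.

(** For [0 < c] this is the projection onto the interval from [- c] to [c]; its complement
    [x - clip c x] is soft thresholding. *)
Definition clip (R : realType) (c x : R) : R := Num.max (- c) (Num.min c x).

Lemma clip0 (R : realType) (c : R) : 0 < c -> clip c 0 = 0.
Proof. by move=> c0; rewrite /clip min_r ?max_r//; lra. Qed.

Lemma clip_homo (R : realType) (c : R) :
  0 < c -> {homo clip c : u v / u <= v}.
Proof.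
move=> c0 u v uv; rewrite /clip.
by case: (leP c u) => ?; case: (leP c v) => ?;
  case: (leP (- c) u) => ?; case: (leP (- c) v) => ?;
  rewrite ?(@max_r _ _ (- c) c); lra.
Qed.

Lemma sub_clip_homo (R : realType) (c : R) :
  0 < c -> {homo (fun x => x - clip c x) : u v / u <= v}.
Proof.
move=> c0 u v uv; rewrite /clip.
by case: (leP c u) => ?; case: (leP c v) => ?;
  case: (leP (- c) u) => ?; case: (leP (- c) v) => ?;
  rewrite ?(@max_r _ _ (- c) c); lra.
Qed.

(** No nonzero value lies strictly between [- c] and [c], so clipping saturates. This makes the
    clipped vector a multiple of a sign vector. *)
Lemma clip_sg (R : realType) (c x : R) :
  0 < c -> (x != 0 -> c <= `|x|) -> clip c x = c * Num.sg x.
Proof.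
move=> c0; have [-> _|x0 /(_ isT) cx] := eqVneq x 0.
  by rewrite clip0// sgr0 mulr0.
rewrite /clip; case: (ltgtP x 0) x0 cx => // [xn|xp] _ cx.
- by rewrite ltr0_sg// ltr0_norm// in cx *; rewrite min_r ?max_l//; lra.
- by rewrite gtr0_sg// gtr0_norm// in cx *; rewrite min_l ?max_r//; lra.
Qed.

Lemma sign_vectors_sg (R : realType) m (S : {set 'I_m}) (a : 'rV[R]_m) :
  coord_space S a -> sign_vectors (coord_space S) (map_mx Num.sg a).
Proof.
move=> Ua; split; first by apply: coord_space_map; rewrite ?sgr0.
by move=> i; rewrite mxE !inE; case: sgrP; rewrite eqxx ?orbT.
Qed.

(** Superadditivity of [f] is assumed only along the thresholding decomposition: in case (ii), with
    arbitrary coefficients, it can fail for general pairs. *)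
Lemma le_of_sign_vectors (R : realType) m (S : {set 'I_m})
    (phi f : 'rV[R]_m -> R) :
  let U := @coord_space R m S in
  pos_homogeneous U phi -> pos_homogeneous U f ->
  (forall x y, U x -> U y -> phi (x + y) <= phi x + phi y) ->
  (forall c a, 0 < c -> U a ->
     f (map_mx (fun x => x - clip c x) a) + f (map_mx (clip c) a) <= f a) ->
  (forall a, sign_vectors U a -> phi a <= f a) ->
  forall a, U a -> phi a <= f a.
Proof.
move=> U phih fh phiD fD sgn a.
have [n] := ubnP #|[set i | a 0 i != 0]%SET|; elim: n a => // n IH a an Ua.
have [a0|[i0 ai0]] : a = 0 \/ exists i, a 0 i != 0.
  have [|/existsP] := boolP [exists i, a 0 i != 0]; first by move=> /existsP; right.
  move=> a0; left; apply/rowP => i; rewrite mxE.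
  by apply/eqP/negPn/negP => ai; apply: a0; exists i.
(* The zero vector is itself a sign vector. *)
- by apply: sgn; split=> // i; rewrite a0 mxE !inE eqxx orbT.
pose i1 := [arg min_(i < i0 | a 0 i != 0) `|a 0 i|]%O.
have [ai1 i1min] : a 0 i1 != 0 /\ forall i, a 0 i != 0 -> `|a 0 i1| <= `|a 0 i|.
  by rewrite /i1; case: arg_minP.
pose c := `|a 0 i1|; have c0 : 0 < c by rewrite normr_gt0.
pose b := map_mx (fun x => x - clip c x) a.
have clipE i : clip c (a 0 i) = c * Num.sg (a 0 i) by apply: clip_sg => // /i1min.
have hE : map_mx (clip c) a = c *: map_mx Num.sg a.
  by apply/rowP => i; rewrite !mxE clipE.
have aE : a = b + c *: map_mx Num.sg a.
  by rewrite -hE; apply/rowP => i; rewrite !mxE subrK.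
have Ub : U b by apply: coord_space_map => //; rewrite clip0// subr0.
have Us := sign_vectors_sg Ua.
have Ucs : U (c *: map_mx Num.sg a).
  by rewrite -hE; apply: coord_space_map => //; rewrite clip0.
have phib : phi b <= f b.
  apply: IH => //; rewrite -ltnS; apply: leq_trans an; rewrite ltnS.
  (* Thresholding fixes 0, so the support does not grow; it loses [i1], where the absolute value is
     exactly [c]. *)
  apply: proper_card; apply/properP; split.
    apply/fintype.subsetP => i; rewrite !inE mxE; apply: contraNneq => ->.
    by rewrite clip0// subr0.
  by exists i1; rewrite !inE ?mxE ?clipE // mulrC mulr_sg_norm subrr eqxx.
(* Only the argument of [phi] is decomposed; [f a] stays whole, to be bounded below by [fD]. *)
rewrite {1}aE; apply: (le_trans (phiD _ _ Ub Ucs)).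
apply: le_trans (fD c a c0 Ua); rewrite hE phih ?fh//; last 2 first.
- exact: Us.1.
- exact: Us.1.
by apply: lerD => //; rewrite ler_pM2l// sgn.
Qed.

Theorem theorem2p2 (R : realType) (t m : nat) (P : 'I_t -> {set 'I_m})
    (P_inj : injective P)
    (P_partition : finset.partition [set P i | i : 'I_t]%SET [set: 'I_m]%SET)
    (calP : {set 'I_m}) (phi f : 'rV[R]_m -> R) :
  let U := @coord_space R m calP in
  @convex_function R 'rV[R]_m U phi ->
  pos_homogeneous U phi ->
  (concave_function U f /\ pos_homogeneous U f) \/
  (exists alpha : forall i : 'I_t, 'I_#|P i| -> R,
     forall a : 'rV[R]_m, U a ->
       f a = \sum_(i < t) \sum_(j < #|P i|)
               alpha i j * decr (restrict_row a (P i)) j) ->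
  ((forall a : 'rV[R]_m, U a -> phi a <= f a) <->
   (forall a : 'rV[R]_m, sign_vectors U a -> phi a <= f a)).
Proof.
move=> U phiconv phihom fcase; split=> [H a [Ua _]|]; first exact: H.
have UZ c x : 0 < c -> U x -> U (c *: x).
  by move=> _ /coord_spaceP Ux; apply/coord_spaceP => i /Ux; rewrite mxE => ->; rewrite mulr0.
have UM c x : 0 < c -> U x ->
    U (map_mx (fun y => y - clip c y) x) /\ U (map_mx (clip c) x).
  by move=> c0 Ux; split; apply: coord_space_map => //; rewrite clip0 ?subr0.
have phiD := convex_pos_homogeneous_subadd UZ phiconv phihom.
case: fcase => [[fconc fhom]|[alpha fE]].
  apply: le_of_sign_vectors => // c a c0 Ua; have [Ub Uh] := UM _ _ c0 Ua.
  (* Superadditivity of [f] is subadditivity of the convex function [- f]. *)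
  have Nfhom : pos_homogeneous U (fun x => - f x).
    by move=> d v d0 Uv; rewrite fhom// mulrN.
  have := convex_pos_homogeneous_subadd UZ fconc Nfhom Ub Uh.
  rewrite -opprD lerN2; congr (_ <= f _).
  by apply/rowP => i; rewrite !mxE subrK.
apply: le_of_sign_vectors => //.
  move=> c v c0 Uv; rewrite !fE//; last exact: UZ.
  rewrite mulr_sumr; apply: eq_bigr => i _.
  rewrite mulr_sumr; apply: eq_bigr => j _.
  (* Scaling by [c > 0] is also a nondecreasing coordinatewise map, so [decr_map] yields homogeneity
     too. *)
  have -> : c *: v = map_mx ( *%R c) v by apply/rowP => k; rewrite !mxE.
  rewrite restrict_row_map decr_map 1?mulrCA// => x y xy.
  by rewrite ler_pM2l.
move=> c a c0 Ua; have [Ub Uh] := UM _ _ c0 Ua; rewrite !fE//.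
(* Here equality holds, term by term: at each sorted coordinate the thresholded and clipped values
   add back to the original one. *)
rewrite le_eqVlt -big_split/=; apply/orP; left; apply/eqP.
apply: eq_bigr => i _; rewrite -big_split/=; apply: eq_bigr => j _.
rewrite !restrict_row_map (decr_map _ _ (sub_clip_homo c0)).
by rewrite (decr_map _ _ (clip_homo c0)) -mulrDr subrK.
Qed.
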